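(* Let $X$ be a nonempty perfect Polish space. For every continuous map $T: X\to X$, there is a dense $G_\delta$ set $Y\subseteq X$ such that $Y$ (with the subspace topology) is homeomorphic to the Baire space $\mathbb{N}^{\mathbb{N}}$ and $T(Y)\subseteq Y$.
   Context: A Polish space is a separable completely metrizable topological space; it is perfect if it has no isolated points. $\mathbb{N}^{\mathbb{N}}$ carries the product topology of discrete spaces. *)

(* Defs.v *)
From mathcomp Require Import all_boot all_order all_algebra.
From mathcomp Require Import all_classical all_reals all_analysis.

Set Implicit Arguments.
Unset Strict Implicit.
Unset Printing Implicit Defensive.

Import Order.TTheory GRing.Theory Num.Theory.

Local Open Scope classical_set_scope.
Local Open Scope ring_scope.

Definition separable (X : topologicalType) : Prop :=
  exists2 D : set X, countable D & dense D.

(* The axioms are those of the factory [isMetric]; nonnegativity follows. *)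
Definition is_distance (R : realType) (X : Type) (d : X -> X -> R) : Prop :=
  [/\ forall x, d x x = 0,
      forall x y, d x y = 0 -> x = y,
      forall x y, d x y = d y x &
      forall y x z, d x z <= d x y + d y z].

Definition induces_topology (R : realType) (X : topologicalType)
    (d : X -> X -> R) : Prop :=
  forall x : X, nbhs x = nbhs_ball_ (fun y e => [set z | d y z < e]) x.

Definition complete_distance (R : realType) (X : topologicalType)
    (d : X -> X -> R) : Prop :=
  forall u : nat -> X,
    (forall e : R, 0 < e -> exists N : nat, forall m n : nat,
      (N <= m)%N -> (N <= n)%N -> d (u m) (u n) < e) ->
    exists l : X, u @ \oo --> l.

(* Metrizability is a property of the topology of [X]: no metric structure on
   [X] is fixed. *)
Definition completely_metrizable (R : realType) (X : topologicalType) : Prop :=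
  exists d : X -> X -> R,
    [/\ is_distance d, induces_topology d & complete_distance d].

Definition polish (R : realType) (X : topologicalType) : Prop :=
  separable X /\ completely_metrizable R X.

Definition perfect (X : topologicalType) : Prop := isolated [set: X] = set0.

Definition homeomorphic (A B : topologicalType) : Prop :=
  exists (f : A -> B) (g : B -> A),
    [/\ cancel f g, cancel g f, continuous f & continuous g].

(* The library topology on [nat] is discrete. *)
Definition baire_space : topologicalType := prod_topology (fun _ : nat => nat).

(* Main.v *)
Require Import Defs.
From mathcomp Require Import all_boot all_order all_algebra.
From mathcomp Require Import all_classical all_reals all_analysis.
From mathcomp Require Import borel_hierarchy.

(** The idea is to delete from [X] a meager set [Z], made of closed sets with
empty interior and stable under preimages by [T], so large that what remains
is totally disconnected and nowhere locally compact. Its complement [Y] is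
then a dense G-delta by Baire's theorem, [T] maps [Y] into [Y], and the
Alexandrov-Urysohn characterization identifies [Y] with the Baire space.

The difficulty is that the preimage by an iterate of [T] of a closed set with
empty interior may well have interior: for a constant [T], the value of [T]
cannot be deleted. The way out is to choose the deleted sets inside
uncountable disjoint families. Given a disjoint family of subsets of the
separable space [X], the preimages of its members by a fixed iterate of [T]
are again disjoint, so only countably many have nonempty interior; over all
iterates, only countably many members are bad
([countable_interior_preimages]). Two families are used.
- The spheres about a fixed point. All radii but countably many are good, so
  each point has arbitrarily small balls, of good radius and centered in a
  fixed dense sequence, whose bounding spheres can be deleted. These balls
  become clopen in [Y].
- The points of a ball. Since [X] is perfect and completely metrizable, every
  nonempty open set is uncountable ([open_avoid_countable]), so it contains a
  good point. Deleting one such point from each ball of a countable base makes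
  the complement of [Y] dense; hence no nonempty open set of [X] has the trace
  of a compact set on [Y].
The set [Z] consists of the preimages, by all iterates of [T], of the chosen
spheres and points.

The homeomorphism ([homeomorphic_baire_space]) comes from a Lusin scheme. An
open set whose closure adds no point of [Y] is split into infinitely many
small disjoint nonempty sets of the same kind that cover its trace on [Y] and
whose closures avoid a prescribed piece of [Z] ([refinement]). Density of [Z]
forces the number of pieces to be infinite. Completeness gives one point on
each branch of the resulting tree; this point avoids all of [Z], and [Y]
becomes the space of branches. *)

Set Implicit Arguments.
Unset Strict Implicit.
Unset Printing Implicit Defensive.

Import Order.TTheory GRing.Theory Num.Theory.

Local Open Scope classical_set_scope.

(** * Splitting a relatively clopen set into infinitely many pieces *)

(** For dense [Y], open sets of this kind stand for their traces on [Y], which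
are clopen there. Working with subsets of [X] keeps their closures in the
complete space at hand. *)
Definition clopen_in (X : topologicalType) (Y U : set X) :=
  open U /\ closure U `&` Y `<=` U.

Lemma closure_disjoint_open (X : topologicalType) (A U : set X) :
  open U -> A `&` U = set0 -> closure A `&` U = set0.
Proof.
move=> oU AU; rewrite -subset0 => x [clAx Ux].
by have := clAx U (open_nbhs_nbhs (conj oU Ux)); rewrite AU => -[].
Qed.

(** The usual disjoint refinement, except that closures are removed so as to
stay among open sets. The points lost lie on boundaries, outside [Y]. *)
Definition disjointed (X : topologicalType) (B : nat -> set X) (j : nat) :=
  B j `\` \bigcup_(i in `I_j) closure (B i).

Lemma clopen_in_disjointed (X : topologicalType) (Y : set X)
    (B : nat -> set X) (j : nat) :
  (forall i, clopen_in Y (B i)) -> clopen_in Y (disjointed B j).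
Proof.
move=> cB; split.
  rewrite /disjointed setDE; apply: openI; first exact: (cB j).1.
  rewrite openC; apply: closed_bigcup => [|i _]; first exact: finite_II.
  exact: closed_closure.
move=> y [cly Yy]; split.
  by apply: (cB j).2; split=> //; apply: closureS cly; exact: subDsetl.
move=> [i /= ij cly'].
have Biy : B i y by apply: (cB i).2.
suff : (closure (disjointed B j) `&` B i) y.
  rewrite closure_disjoint_open//; first exact: (cB i).1.
  rewrite -subset0 => z [[_ nz] Biz]; apply: nz; exists i => //.
  exact: subset_closure.
by split.
Qed.

Lemma trivIset_disjointed (X : topologicalType) (B : nat -> set X) :
  trivIset setT (disjointed B).
Proof.
suff H i j : (i < j)%N -> disjointed B i `&` disjointed B j = set0.
  move=> i j _ _ [x [Bix Bjx]]; case: (ltngtP i j) => // /H E.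
    by have : set0 x by rewrite -E.
  by have : set0 x by rewrite -E.
move=> ij; rewrite -subset0 => x [[Bix _] [_ nx]].
by apply: nx; exists i => //; exact: subset_closure.
Qed.

Lemma bigcup_disjointed (X : topologicalType) (Y : set X) (B : nat -> set X) :
  (forall i, clopen_in Y (B i)) ->
  (\bigcup_j B j) `&` Y `<=` \bigcup_j disjointed B j.
Proof.
move=> cB y [[k _ Bky] Yy].
have ex : exists j, `[< B j y >] by exists k; apply/asboolP.
exists (ex_minn ex) => //; case: ex_minnP => j /asboolP Bjy jmin.
split=> // -[i /= ij cly]; suff : (j <= i)%N by rewrite leqNgt ij.
by apply/jmin/asboolP/(cB i).2.
Qed.

Lemma infinite_set_bij (A : set nat) : infinite_set A ->
  exists f : nat -> nat, set_bij [set: nat] A f.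
Proof.
move=> /infiniteP iA; apply/card_set_bijP/card_eqPle; split=> //.
exact: countableP.
Qed.

(** The family [V] is what one node of the Lusin scheme needs as its children
when [U] is the node and [F] the closed set to be avoided. *)
Definition refines (X : topologicalType) (small : set X -> Prop)
    (Y U F : set X) (V : nat -> set X) :=
  [/\ forall i, V i !=set0 /\ clopen_in Y (V i),
      forall i, closure (V i) `<=` U `\` F /\ small (V i),
      U `&` Y `<=` \bigcup_i V i & trivIset setT V].

(** Cover [U `\` F] by small basic sets with closure inside it, make them
disjoint, and discard the empty ones. Infinitely many survive: the closures of
finitely many would form a closed set containing the trace of [U] on the dense
set [Y], hence [U] itself, although [U] meets [F]. *)
Lemma refinement (X : topologicalType) (small : set X -> Prop) (Y U F : set X)
    (B : nat -> set X) :
  (forall A A' : set X, A `<=` A' -> small A' -> small A) ->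
  dense Y ->
  (forall j, clopen_in Y (B j)) ->
  (forall (O : set X) y, open O -> O y ->
     exists j, [/\ B j y, closure (B j) `<=` O & small (B j)]) ->
  open U -> closed F -> F `&` Y = set0 -> U `&` F !=set0 ->
  exists V, refines small Y U F V.
Proof.
move=> smallS dY cB baseB oU cF FY UF.
pose C j := if `[< closure (B j) `<=` U `\` F /\ small (B j) >] then B j
            else set0.
have oUF : open (U `\` F) by rewrite setDE; apply: openI => //; rewrite openC.
have cC j : clopen_in Y (C j).
  rewrite /C; case: asboolP => // _; split; first exact: open0.
  by rewrite closure0 set0I.
have CUF j : closure (C j) `<=` U `\` F.
  by rewrite /C; case: asboolP => [[]//|_]; rewrite closure0.
pose D := disjointed C.
have DC j : D j `<=` C j by exact: subDsetl.
have DUF j : closure (D j) `<=` U `\` F.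
  by apply: subset_trans (CUF j); exact/closureS.
have UD : U `&` Y `<=` \bigcup_j D j.
  move=> y [Uy Yy]; apply: (bigcup_disjointed cC); split=> //.
  have [|j [Bjy clBj sBj]] := baseB _ y oUF.
    by split=> // Fy; suff : set0 y by []; rewrite -FY.
  by exists j => //; rewrite /C; case: asboolP => // -[].
pose J := [set j | D j !=set0].
have infJ : infinite_set J.
  move=> finJ; have [x [Ux Fx]] := UF.
  have cl : closed (\bigcup_(j in J) closure (D j)).
    by apply: closed_bigcup => // i _; exact: closed_closure.
  have [j _ /DUF[]//] : (\bigcup_(j in J) closure (D j)) x.
  (* [x] is a limit of points of [U `&` Y], which the sets [D j] cover. *)
  apply: cl => N xN.
  have [y [[Ny Uy] Yy]] : (N° `&` U) `&` Y !=set0.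
    apply: dY; last by apply: openI => //; exact: open_interior.
    by exists x.
  have [j _ Djy] := UD y (conj Uy Yy).
  exists y; split; last exact: interior_subset.
  by exists j; [exists y|exact: subset_closure].
have [f [fJ finj fsurj]] := infinite_set_bij infJ.
exists (D \o f); split.
- by move=> i; split; [exact: fJ|exact: clopen_in_disjointed].
- move=> i /=; split; first exact: DUF.
  apply: smallS (DC (f i)) _.
  have [y /DC] : D (f i) !=set0 by exact: fJ.
  by rewrite /C; case: asboolP => [[]//|].
- move=> y /UD[j _ Djy].
  have [i _ fij] : (f @` setT) j by apply: fsurj; exists y.
  by exists i => //=; rewrite fij.
- move=> i j _ _ /= /trivIset_disjointed fij; apply: finj; rewrite ?inE//.
  exact: fij.
Qed.

(** * Complete metrics and Baire's theorem *)

Local Open Scope ring_scope.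

Definition ball_of (R : realType) (X : Type) (d : X -> X -> R) (x : X)
    (r : R) := [set y | d x y < r].

Definition thin (R : realType) (X : Type) (d : X -> X -> R) (e : R)
    (U : set X) := forall x y, U x -> U y -> d x y < e.

Lemma thinS (R : realType) (X : Type) (d : X -> X -> R) (e : R) (A B : set X) :
  A `<=` B -> thin d e B -> thin d e A.
Proof. by move=> AB tB x y /AB Bx /AB By; exact: tB. Qed.

Section metrized_space.
Context (R : realType) (X : topologicalType) (d : X -> X -> R).
Hypotheses (dist_d : is_distance d) (top_d : induces_topology d).

Let dxx x : d x x = 0. Proof. by case: dist_d. Qed.
Let d_sym x y : d x y = d y x. Proof. by case: dist_d. Qed.
Let d_tri y x z : d x z <= d x y + d y z. Proof. by case: dist_d. Qed.

Lemma dist_ge0 x y : 0 <= d x y.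
Proof.
have := d_tri y x x; rewrite dxx (d_sym y x) -mulr2n.
by rewrite pmulrn_lge0.
Qed.

Lemma nbhs_distP (x : X) (A : set X) :
  nbhs x A <-> exists2 e, 0 < e & ball_of d x e `<=` A.
Proof. by rewrite top_d; split=> -[e e0 eA]; exists e. Qed.

Lemma open_ball_of x r : open (ball_of d x r).
Proof.
rewrite openE => y /= xyr; apply/nbhs_distP; exists (r - d x y).
  by rewrite subr_gt0.
move=> z /= yz; apply: le_lt_trans (d_tri y x z) _.
by rewrite -ltrBrDl.
Qed.

Lemma closed_le_dist x r : closed [set y | d x y <= r].
Proof.
rewrite -openC openE => y /negP; rewrite -ltNge => rxy.
apply/nbhs_distP; exists (d x y - r); first by rewrite subr_gt0.
move=> z /= yz; apply/negP; rewrite -ltNge.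
have := d_tri z x y; rewrite (d_sym z y) => xyz.
by rewrite -(ltrD2r (d y z)) (lt_le_trans _ xyz)// -ltrBrDl.
Qed.

Lemma closure_ball_of x r : closure (ball_of d x r) `<=` [set y | d x y <= r].
Proof.
by move=> y /(closureS (fun z => @ltW _ _ _ _))/closed_le_dist.
Qed.

Lemma closed_sphere x r : closed [set y | d x y = r].
Proof.
rewrite (_ : mkset _ = [set y | d x y <= r] `&` ~` ball_of d x r).
  apply: closedI; first exact: closed_le_dist.
  by rewrite closedC; exact: open_ball_of.
apply/seteqP; split=> y /= => [xyr|[xyr /negP]].
  by rewrite /ball_of /= xyr lexx ltxx.
by rewrite -leNgt => rxy; apply/eqP; rewrite eq_le xyr.
Qed.

Lemma dist_eq0 x y : (forall n, d x y < n.+1%:R^-1) -> x = y.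
Proof.
move=> small; case: dist_d => _ sep _ _; apply/sep/eqP; rewrite eq_le dist_ge0.
rewrite andbT leNgt; apply/negP => dpos.
have [n] := ltr_add_invr dpos; rewrite add0r => /ltW.
by rewrite leNgt small.
Qed.

Lemma closed_point (x : X) : closed [set x].
Proof.
rewrite (_ : [set x] = [set y | d x y = 0]); first exact: closed_sphere.
apply/seteqP; split=> y /= => [->|]; first exact: dxx.
by case: dist_d => _ sep _ _ /sep.
Qed.

Lemma shrink (O : set X) x e : open O -> O x -> 0 < e ->
  exists V, [/\ open V, V x, closure V `<=` O & thin d e V].
Proof.
move=> oO Ox e0; have /nbhs_distP[r r0 rO] := open_nbhs_nbhs (conj oO Ox).
pose s := Num.min (r / 2) (e / 2).
have s0 : 0 < s by rewrite lt_min !divr_gt0.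
exists (ball_of d x s); split.
- exact: open_ball_of.
- by rewrite /ball_of /= dxx.
- move=> y /closure_ball_of /= xys; apply: rO; rewrite /ball_of /=.
  apply: le_lt_trans xys _; rewrite gt_min ltr_pdivrMr// ltr_pMr// ltr1n.
  by [].
- move=> y z; rewrite /ball_of /= !lt_min => /andP[_ xy] /andP[_ xz].
  apply: le_lt_trans (d_tri x y z) _; rewrite d_sym [ltRHS]splitr.
  exact: ltrD.
Qed.

Hypothesis complete_d : complete_distance d.

(** Cantor's intersection theorem for sets that need not be closed: a point in
the closure of each [U n.+1] lies in each [U n]. It serves both Baire's theorem
and the Lusin scheme. *)
Lemma nested_point (U : nat -> set X) :
  (forall n, U n !=set0) -> (forall n, closure (U n.+1) `<=` U n) ->
  (forall n, thin d n.+1%:R^-1 (U n.+1)) -> exists x, forall n, U n x.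
Proof.
move=> /choice[u uU] clU thU.
have decr m n : (m <= n)%N -> U n `<=` U m.
  elim: n => [|n IH]; first by rewrite leqn0 => /eqP ->.
  rewrite leq_eqVlt => /predU1P[-> //|/IH]; apply: subset_trans.
  by apply: subset_trans (clU n); exact: subset_closure.
have [e e0|l ul] := complete_d (u := u).
  have [n] := ltr_add_invr e0; rewrite add0r => ne; exists n.+1 => i j ni nj.
  apply: lt_trans ne; apply: thU; first exact: decr (uU i).
  exact: decr (uU j).
exists l => n; apply: clU => N lN.
have [k _ kN] := ul N lN.
exists (u (maxn n.+1 k)); split; first exact: decr (leq_maxl _ _) _ (uU _).
by apply: kN => /=; exact: leq_maxr.
Qed.

Lemma baire_category (O : nat -> set X) :
  (forall n, open (O n)) -> (forall n, dense (O n)) ->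
  dense (\bigcap_n O n).
Proof.
move=> oO dO U U0 oU.
pose good (A : set X) := A !=set0 /\ open A.
have step (p : nat * set X) : exists V, good p.2 -> [/\ good V,
    closure V `<=` p.2 `&` O p.1 & thin d p.1.+1%:R^-1 V].
  have [[A0 oA]|] := pselect (good p.2); last by exists set0.
  have [x AOx] := dO p.1 _ A0 oA.
  have e0 : 0 < p.1.+1%:R^-1 :> R by [].
  have [V [oV Vx clV tV]] := shrink (openI oA (oO p.1)) AOx e0.
  by exists V => _; split=> //; split=> //; exists x.
have [next nextP] := choice step.
pose W := fix W n := if n is n'.+1 then next (n', W n') else U.
have gW n : good (W n).
  by elim: n => [//|n IH]; have [] := nextP (n, W n) IH.
have [|||x Wx] := @nested_point W.
- by move=> n; exact: (gW n).1.
- by move=> n y; have [_ + _] := nextP (n, W n) (gW n) => /[apply] -[].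
- by move=> n; have [_ _] := nextP (n, W n) (gW n).
exists x; split; first exact: Wx 0%N.
move=> n _; have [_ + _] := nextP (n, W n) (gW n).
by move=> /(_ x (subset_closure (Wx n.+1)))[].
Qed.

End metrized_space.

(** * The Lusin scheme *)

Section scheme.
Variables (X : topologicalType) (next : nat * set X -> nat -> set X).

(** The node reached from the root [setT] by following the first [n] labels of
[s], when [next (m, U)] lists the children of the node [U] of depth [m]. The
nodes are computed along the branch, which replaces an indexing of the tree by
finite sequences. *)
Fixpoint branch (s : nat -> nat) (n : nat) : set X :=
  if n is n'.+1 then next (n', branch s n') (s n') else setT.

Lemma eq_branch s t n :
  (forall k, (k < n)%N -> s k = t k) -> branch s n = branch t n.
Proof.
elim: n => // n IH st /=; rewrite IH ?st// => k kn.
by apply: st; exact: ltnW.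
Qed.

(** Siblings are disjoint, so agreement of two branches through [x] propagates
from each label to the next one. *)
Lemma branch_inj s t n x :
  (forall u m, trivIset setT (next (m, branch u m))) ->
  (forall m, (m <= n)%N -> branch s m x) ->
  (forall m, (m <= n)%N -> branch t m x) ->
  forall k, (k < n)%N -> s k = t k.
Proof.
move=> triv sx tx k; elim/ltn_ind: k => k IH kn.
have E : branch s k = branch t k.
  by apply: eq_branch => j jk; apply: IH => //; exact: ltn_trans jk kn.
apply: (triv s k) => //; exists x; split; first exact: sx kn.
by rewrite E; exact: tx kn.
Qed.

Lemma exists_branch (Y : set X) y : Y y ->
  (forall s n, branch s n `&` Y `<=` \bigcup_i next (n, branch s n) i) ->
  exists s, forall n, branch s n y.
Proof.
move=> Yy cover.
have /choice[pick pickP] p :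
    exists j, (exists i, next p i y) -> next p j y.
  have [[i iy]|ni] := pselect (exists i, next p i y).
    by exists i.
  by exists 0%N => /ni.
pose W := fix W n := if n is n'.+1 then next (n', W n') (pick (n', W n'))
                     else setT.
pose s n := pick (n, W n).
have sW n : branch s n = W n by elim: n => //= n ->.
exists s; elim=> // n IH; rewrite /= sW; apply: pickP.
by have [i _ iy] := cover s n y (conj IH Yy); exists i; rewrite -sW.
Qed.

End scheme.

Lemma cylinder_nbhs (s : baire_space) (n : nat) :
  nbhs s [set t : baire_space | forall k, (k < n)%N -> s k = t k].
Proof.
elim: n => [|n IH].
  by apply: filterS filterT => t _ k; rewrite ltn0.
have sn : nbhs s [set t : baire_space | s n = t n].
  have /= := @proj_continuous nat (fun=> nat) n s [set m | s n = m].
  by apply; rewrite nbhs_principalE; apply/principal_filterP.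
apply: filterS (filterI IH sn) => t [tn tsn] k.
by rewrite ltnS leq_eqVlt => /predU1P[->|/tn].
Qed.

Lemma continuous_baire_space (A : topologicalType) (g : A -> baire_space) :
  (forall a n, nbhs a [set b | g a n = g b n]) -> continuous g.
Proof.
move=> loc a; apply/cvg_sup => n; apply/cvg_image.
  by apply/seteqP; split=> // m _; exists (fun=> m).
move=> U; rewrite nbhs_principalE => /principal_filterP Uan.
exists ([set s : baire_space | U (s n)]); last first.
  apply/seteqP; split=> [m [s Us <-//]|m Um]; by exists (fun=> m).
by apply: filterS (loc a n) => b /= <-.
Qed.

(** * Recognizing the Baire space *)

Section homeomorphism.
Context (R : realType) (X : topologicalType) (d : X -> X -> R).
Hypotheses (dist_d : is_distance d) (top_d : induces_topology d).
Hypothesis complete_d : complete_distance d.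

(** The Alexandrov-Urysohn theorem for a G-delta subset [Y] of a complete
metric space: the sets [B j] make [Y] zero-dimensional, and density of the
complement of [Y] prevents compact subsets of [Y] from having interior in
[Y]. *)
Lemma homeomorphic_baire_space (Y : set X) (F B : nat -> set X) :
  [set: X] !=set0 -> Y = ~` (\bigcup_n F n) -> (forall n, closed (F n)) ->
  dense Y -> dense (~` Y) -> (forall j, clopen_in Y (B j)) ->
  (forall (O : set X) y e, open O -> O y -> 0 < e ->
     exists j, [/\ B j y, closure (B j) `<=` O & thin d e (B j)]) ->
  homeomorphic (set_type Y) baire_space.
Proof.
move=> X0 YF cF dY dYC cB baseB.
have FY n : F n `&` Y = set0.
  by rewrite -subset0 YF => x [Fx]; apply; exists n.
pose live (U : set X) := U !=set0 /\ clopen_in Y U.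
have liveT : live setT by split=> //; split=> //; exact: openT.
have /choice[next nextP] (p : nat * set X) : exists V,
    live p.2 -> refines (thin d p.1.+1%:R^-1) Y p.2 (F p.1) V.
  case: p => n U /=.
  have [[[x Ux] cU]|nl] := pselect (live U); last by exists (fun=> set0) => /nl.
  have [z [Uz nYz]] : U `&` ~` Y !=set0 by apply: dYC; [exists x|exact: cU.1].
  have [m _ Fmz] : (\bigcup_n F n) z by move: nYz; rewrite YF setCK.
  (* [F n] may miss [U]; adding a set [F m] that meets [U] makes the splitting
     infinite. *)
  have [||||||||V [V1 V2 V3 V4]] :=
    @refinement X (thin d n.+1%:R^-1) Y U (F n `|` F m) B => //.
  - by move=> A A'; exact: thinS.
  - by move=> O y oO Oy; exact: baseB.
  - exact: cU.1.
  - exact: closedU.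
  - by rewrite setIUl !FY setU0.
  - by exists z; split=> //; right.
  exists V => _; split; [exact: V1| |exact: V3|exact: V4].
  move=> i; have [clV tV] := V2 i.
  by split=> // y /clV[Uy nFy]; split=> // Fny; apply: nFy; left.
have live_branch s n : live (branch next s n).
  elim: n => // n IH; have [+ _ _ _] := nextP (n, _) IH.
  exact.
have ref s n := nextP (n, _) (live_branch s n).
have triv s n : trivIset setT (next (n, branch next s n)).
  by case: (ref s n).
have cover s n :
    branch next s n `&` Y `<=` \bigcup_i next (n, branch next s n) i.
  by case: (ref s n).
have thin_branch s n : thin d n.+1%:R^-1 (branch next s n.+1).
  by have [_ + _ _] := ref s n => /(_ (s n))[].
have clbranch s n :
    closure (branch next s n.+1) `<=` branch next s n `\` F n.
  by have [_ + _ _] := ref s n => /(_ (s n))[].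
have branchS s m n : (m <= n)%N -> branch next s n `<=` branch next s m.
  elim: n => [|n IH]; first by rewrite leqn0 => /eqP ->.
  rewrite leq_eqVlt => /predU1P[-> //|/IH]; apply: subset_trans => x.
  by move=> /subset_closure /clbranch[].
have /choice[f fP] s :
    exists y : set_type Y, forall n, branch next s n (val y).
  have [|||x sx] := @nested_point _ _ _ complete_d (branch next s).
  - by move=> n; exact: (live_branch s n).1.
  - by move=> n x /clbranch[].
  - exact: thin_branch.
  have Yx : Y x.
    rewrite YF => -[n _ Fx].
    by have [] := clbranch s n x (subset_closure (sx n.+1)).
  by exists (SigSub (mem_set Yx)).
have /choice[g gP] (y : set_type Y) :
    exists s, forall n, branch next s n (val y).
  by case: y => y Yy; exact: (exists_branch (set_mem Yy)).
exists g, f; split.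
- move=> y; apply: val_inj; apply: (dist_eq0 dist_d) => n.
  exact: thin_branch (fP _ _) (gP _ _).
- move=> s; apply/funext => n.
  by apply: (@branch_inj _ next _ _ n.+1 (val (f s))) => // m _; exact: gP.
- apply: continuous_baire_space => y n.
  have : nbhs y [set z : set_type Y | branch next (g y) n.+1 (val z)].
    apply: (@initial_continuous _ _ (set_val : set_type Y -> X)).
    apply: open_nbhs_nbhs; split; last exact: gP.
    exact: (live_branch _ _).2.1.
  apply: filterS => z yz /=.
  apply: (@branch_inj _ next _ _ n.+1 (val z)) => // m mn.
  exact: branchS mn _ yz.
- apply: continuous_comp_initial => s U.
  move=> /(nbhs_distP top_d)[e e0 eU].
  have [n] := ltr_add_invr e0; rewrite add0r => ne.
  apply: filterS (cylinder_nbhs s n.+1) => t st; apply: eU => /=.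
  apply: lt_trans ne; apply: (thin_branch s); first exact: fP.
  by rewrite (eq_branch _ st); exact: fP.
Qed.

End homeomorphism.

(** * Avoiding countably many members of a disjoint family *)

Lemma dense_sequence (X : topologicalType) :
  [set: X] !=set0 -> separable X ->
  exists e : nat -> X, forall O : set X, open O -> O !=set0 ->
    exists n, O (e n).
Proof.
move=> [x0 _] [D /countable_injP[f finj] dD].
have /choice[e eP] n : exists x, forall y, D y -> f y = n -> x = y.
  have [[x [Dx fxn]]|nx] := pselect (exists x, D x /\ f x = n).
    by exists x => y Dy fyn; apply: finj; rewrite ?inE// fyn.
  by exists x0 => y Dy fyn; case: nx; exists y.
exists e => O oO O0; have [y [Oy Dy]] := dD O O0 oO.
by exists (f y); rewrite (eP _ y).
Qed.

(** A dense sequence visits each nonempty interior, and by disjointness the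
index of a visit determines the member of the family. *)
Lemma countable_interior (X : topologicalType) (I : Type) (P : I -> set X) :
  [set: X] !=set0 -> separable X -> trivIset setT P ->
  countable [set i | (P i)° !=set0].
Proof.
move=> X0 /(dense_sequence X0)[e eP] tP.
have /choice[h hP] i : exists n, (P i)° !=set0 -> (P i)° (e n).
  have [Pi0|nPi] := pselect ((P i)° !=set0); last by exists 0%N.
  by have [n Pen] := eP _ (@open_interior _ (P i)) Pi0; exists n.
apply/countable_injP; exists h => i j; rewrite !inE => Pi0 Pj0 hij.
apply: tP => //; exists (e (h i)); split; apply: interior_subset.
  exact: hP.
by rewrite hij; exact: hP.
Qed.

(** Preimages of disjoint sets under the same map are disjoint: this is what
makes it possible to delete a set together with all its preimages. *)
Lemma countable_interior_preimages (X : topologicalType) (T : X -> X)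
    (I : Type) (P : I -> set X) :
  [set: X] !=set0 -> separable X -> trivIset setT P ->
  countable [set i | exists n, (iter n T @^-1` P i)° !=set0].
Proof.
move=> X0 sX tP.
rewrite (_ : mkset _ = \bigcup_n [set i | (iter n T @^-1` P i)° !=set0]).
  apply: bigcup_countable => [|n _]; first exact: countableP.
  apply: countable_interior => // i j _ _ [x [xi xj]].
  by apply: tP => //; exists (iter n T x).
by apply/seteqP; split=> i [n]; [exists n|move=> _; exists n].
Qed.

(** Countable sets are Lebesgue negligible, nondegenerate intervals are
not. *)
Lemma interval_avoid_countable (R : realType) (C : set R) (a b : R) :
  a < b -> countable C -> exists r, [/\ a < r, r < b & ~ C r].
Proof.
move=> ab cC; apply: contrapT => H.
have abC : `]a, b[%classic `<=` C.
  move=> r /=; rewrite in_itv /= => /andP[ar rb]; apply: contrapT => nCr.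
  by apply: H; exists r.
have : lebesgue_measure `]a, b[%classic = 0%E :> \bar R.
  by apply: countable_lebesgue_measure0; apply: sub_countable cC;
    exact: subset_card_le.
rewrite lebesgue_measure_itv /= lte_fin ab -EFinD => -[] /eqP.
by rewrite subr_eq0 => /eqP ba; rewrite ba ltxx in ab.
Qed.

Lemma dense_setC_of_interior0 (X : topologicalType) (A : set X) :
  A° = set0 -> dense (~` A).
Proof.
move=> A0 O [x Ox] oO; apply: contrapT => H.
have : A° x; last by rewrite A0.
rewrite /interior; apply: filterS (open_nbhs_nbhs (conj oO Ox)) => y Oy.
by apply: contrapT => nAy; apply: H; exists y.
Qed.

Lemma interior_point (X : topologicalType) (x : X) :
  perfect X -> [set x]° = set0.
Proof.
move=> pX; rewrite -subset0 => y xy.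
have yx := interior_subset xy; rewrite /= in yx; subst y.
have : isolated [set: X] x; last by rewrite pX.
split; first by rewrite inE.
by exists [set x] => //; rewrite setIT.
Qed.

Section perfect_complete.
Context (R : realType) (X : topologicalType) (d : X -> X -> R).
Hypotheses (dist_d : is_distance d) (top_d : induces_topology d).
Hypothesis complete_d : complete_distance d.

(** Points of a perfect space are nowhere dense, so by Baire's theorem the
complement of a countable set is dense. *)
Lemma open_avoid_countable (U C : set X) : perfect X ->
  U !=set0 -> open U -> countable C -> exists x, U x /\ ~ C x.
Proof.
move=> pX U0 oU /countable_injP[f finj].
pose O n := ~` [set x | C x /\ f x = n].
have point n x : C x -> f x = n -> [set x | C x /\ f x = n] = [set x].
  move=> Cx fxn; apply/seteqP; split=> y /= => [[Cy fyn]|->//].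
  by apply: finj; rewrite ?inE// fyn.
have OT n : (exists x, C x /\ f x = n) \/ O n = setT.
  have [Cn|nCn] := pselect (exists x, C x /\ f x = n); first by left.
  by right; apply/seteqP; split=> // x _ Cx; apply: nCn; exists x.
have [||x [Ux Ox]] :=
    @baire_category _ _ _ dist_d top_d complete_d O _ _ U U0 oU.
- move=> n; have [[x [Cx fxn]]|->] := OT n; last exact: openT.
  rewrite /O (point _ x)// openC; exact: closed_point dist_d top_d x.
- move=> n; have [[x [Cx fxn]]|->] := OT n.
    by rewrite /O (point _ x)//; apply/dense_setC_of_interior0/interior_point.
  by move=> A [y Ay] _; exists y.
by exists x; split=> // Cx; exact: (Ox (f x)).
Qed.

End perfect_complete.

(** * The invariant copy of the Baire space *)

Lemma iter_continuous (X : topologicalType) (T : X -> X) (n : nat) :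
  continuous T -> continuous (iter n T).
Proof.
move=> cT; elim: n => [|n IH] x; first exact: cvg_id.
exact: continuous_comp (IH x) (cT _).
Qed.

Theorem theorem2p1 (R : realType) (X : topologicalType)
    (X_nonempty : [set: X] !=set0) (X_polish : polish R X)
    (X_perfect : perfect X) (T : X -> X) (T_continuous : continuous T) :
  exists Y : set X,
    [/\ dense Y, Gdelta Y, homeomorphic (set_type Y) baire_space
      & T @` Y `<=` Y].
Proof.
have [sX [d [dist_d top_d complete_d]]] := X_polish.
have [e eP] := dense_sequence X_nonempty sX.
pose sphere i r := [set y | d (e i) y = r].
have dxx x : d x x = 0 by case: dist_d.
have d_sym x y : d x y = d y x by case: dist_d.
have d_tri y x z : d x z <= d x y + d y z by case: dist_d.
(* The lower bound on the radius lets the ball capture every point close enough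
   to its center. *)
have /choice[rad radP] (ik : nat * nat) : exists r, [/\ ik.2.+2%:R^-1 < r,
    r < ik.2.+1%:R^-1 &
    ~ exists n, (iter n T @^-1` (sphere ik.1 r))° !=set0].
  apply: interval_avoid_countable.
    by rewrite ltf_pV2 ?posrE// ltr_nat.
  apply: (@countable_interior_preimages _ T _ (sphere ik.1)) => //.
  by move=> r s _ _ [x [<- <-]].
have /choice[p pP] (ik : nat * nat) : exists x,
    ball_of d (e ik.1) ik.2.+1%:R^-1 x /\
    ~ exists n, (iter n T @^-1` [set x])° !=set0.
  apply: (open_avoid_countable dist_d top_d complete_d X_perfect).
  - by exists (e ik.1); rewrite /ball_of /= dxx.
  - exact: open_ball_of.
  - apply: (@countable_interior_preimages _ T _ set1) => //.
    by move=> x y _ _ [z [-> ->]].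
(* [inl] indexes the deleted spheres, [inr] the deleted points. *)
pose C (n : nat) (c : (nat * nat) + (nat * nat)) := iter n T @^-1`
  (match c with inl ik => sphere ik.1 (rad ik) | inr ik => [set p ik] end).
have closedC n c : closed (C n c).
  have /continuous_closedP := @iter_continuous _ _ n T_continuous; apply.
  by case: c => ik; [exact: closed_sphere|exact: closed_point dist_d top_d _].
have interiorC n c : (C n c)° = set0.
  rewrite -subset0 => x xC; case: c xC => ik xC.
    by have [_ _] := radP ik; apply; exists n, x.
  by have [_] := pP ik; apply; exists n, x.
(* The default value only repeats one of the [C n c]. *)
pose code m : nat * ((nat * nat) + (nat * nat)) :=
  odflt (0%N, inl (0%N, 0%N)) (unpickle m).
pose F m := C (code m).1 (code m).2.
have CF n c x : C n c x -> (\bigcup_m F m) x.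
  move=> Cx; exists (pickle (n, c)) => //.
  by rewrite /F /code pickleK.
pose Y := ~` (\bigcup_m F m).
have YC n c y : Y y -> ~ C n c y by move=> Yy /CF.
pose B j := let ik := odflt (0%N, 0%N) (unpickle j) in
  ball_of d (e ik.1) (rad ik).
have dY : dense Y.
  rewrite /Y setC_bigcup.
  apply: (baire_category dist_d top_d complete_d) => m.
    by rewrite openC; exact: closedC.
  exact/dense_setC_of_interior0/interiorC.
have baseB (O : set X) y (eps : R) : open O -> O y -> 0 < eps ->
    exists j, [/\ B j y, closure (B j) `<=` O & thin d eps (B j)].
  move=> oO Oy eps0.
  have [V [oV Vy clV tV]] := shrink dist_d top_d oO Oy eps0.
  have /(nbhs_distP top_d)[a a0 aV] := open_nbhs_nbhs (conj oV Vy).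
  have [k] := ltr_add_invr (divr_gt0 a0 (ltr0n _ 2)); rewrite add0r => ka.
  have [|i /= yi] :=
      eP (ball_of d y k.+2%:R^-1) (open_ball_of dist_d top_d _ _).
    by exists y; rewrite /ball_of /= dxx.
  have [rad1 rad2 _] := radP (i, k).
  exists (pickle (i, k)); rewrite /B pickleK /=.
  have BV : closure (ball_of d (e i) (rad (i, k))) `<=` V.
    move=> z /(closure_ball_of dist_d top_d) /= iz; apply: aV => /=.
    rewrite /ball_of /=.
    apply: le_lt_trans (d_tri (e i) y z) _; rewrite [ltRHS]splitr.
    apply: ltrD; first exact: lt_trans yi (lt_trans rad1 (lt_trans rad2 ka)).
    exact: le_lt_trans iz (lt_trans rad2 ka).
  split.
  - by rewrite /ball_of /= d_sym (lt_trans yi).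
  - by apply: subset_trans BV (subset_trans _ clV); exact: subset_closure.
  - by apply: thinS tV; apply: subset_trans BV; exact: subset_closure.
exists Y; split => //.
- exists (fun m => ~` F m); last exact: setC_bigcup.
  by move=> m; rewrite openC; exact: closedC.
- apply: (homeomorphic_baire_space dist_d top_d complete_d
    (F := F) (B := B)) => //.
  + by move=> m; exact: closedC.
  + (* The deleted point of a ball centered near [x] lies in [O]. *)
    rewrite setCK => O [x Ox] oO.
    have /(nbhs_distP top_d)[a a0 aO] := open_nbhs_nbhs (conj oO Ox).
    have [k] := ltr_add_invr (divr_gt0 a0 (ltr0n _ 2)); rewrite add0r => ka.
    have [|i /= xi] := eP (ball_of d x (a / 2)) (open_ball_of dist_d top_d _ _).
      by exists x; rewrite /ball_of /= dxx divr_gt0.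
    have [ip _] := pP (i, k).
    exists (p (i, k)); split; last exact: (CF 0%N (inr (i, k))).
    apply: aO; rewrite /ball_of /=.
    apply: le_lt_trans (d_tri (e i) _ _) _; rewrite [ltRHS]splitr.
    by apply: ltrD => //; exact: lt_trans ip ka.
  + move=> j; rewrite /B; set ik := odflt _ _; split; first exact: open_ball_of.
    move=> y [/(closure_ball_of dist_d top_d) /= le_rad Yy].
    rewrite /ball_of /= lt_neqAle le_rad andbT; apply/eqP => rad_eq.
    exact: (YC 0%N (inl ik) y Yy).
- (* If [T y] lay in [C n c], then [y] would lie in [C n.+1 c]. *)
  move=> _ [y Yy <-] [m _ Fm]; apply: (YC (code m).1.+1 (code m).2 y Yy).
  by rewrite /C /preimage /= -iterS iterSr.
Qed.
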